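(* If $p\in\mathbb{C}[x,y]$ is a binary sextic form divisible by $\ell^2$ for some linear form $\ell$, then $N(p)\le1$.
   Context: For a binary sextic $p$, $N(p)$ is the number of representations $p=f_1^3+f_2^3$ with $f_1,f_2\in\mathbb{C}[x,y]$ non-proportional quadratic forms, where two representations are counted as the same if the unordered pairs $\{f_1^3,f_2^3\}$ coincide. *)

(* Defs.v *)
From HB Require Import structures.
From mathcomp Require Import all_boot all_order all_algebra.
From mathcomp Require Import finmap complex mpoly.
From mathcomp Require Import boolp classical_sets functions cardinality.
From mathcomp Require Import reals constructive_ereal counting_measure.

Set Implicit Arguments.
Unset Strict Implicit.
Unset Printing Implicit Defensive.

Import Order.TTheory GRing.Theory Num.Theory.

Local Open Scope ring_scope.
Local Open Scope complex_scope.
Local Open Scope classical_set_scope.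

Section CubeRepresentations.
Variable R : realType.
Implicit Types p f g : {mpoly R[i][2]}.

(* Symmetric in f and g; the zero form is proportional to every form. *)
Definition proportional f g : Prop :=
  exists a b : R[i], ((a, b) != (0, 0)) /\ a *: f = b *: g.

(* Each representation p = f1 ^+ 3 + f2 ^+ 3 is recorded by the unordered pair
   {f1 ^+ 3, f2 ^+ 3}, so that permuting f1 and f2, or multiplying them by cube
   roots of unity, gives the same element of this set. *)
Definition cube_reps p : set {fset {mpoly R[i][2]}} :=
  [set S | exists f1 f2 : {mpoly R[i][2]},
     [/\ f1 \is 2.-homog, f2 \is 2.-homog, ~ proportional f1 f2,
         p = f1 ^+ 3 + f2 ^+ 3 & S = [fset f1 ^+ 3; f2 ^+ 3]%fset]].

(* The value is +oo when there are infinitely many representations. *)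
Definition N p : \bar R := counting (cube_reps p).

End CubeRepresentations.

(* Main.v *)
(* Restrict the forms to the affine line on which [l] becomes the coordinate [t]:
   quadratic forms become polynomials of degree at most 2, faithfully.  If [t^2]
   divides [f1^3 + f2^3], there are two cases.  Either [t] divides both [f1] and
   [f2], and the claim reduces to the uniqueness of a binary cubic as a sum of two
   cubes of independent linear forms.  Or, up to cube roots of unity,
   [f1 = c t^2 / 2 + h] and [f2 = c t^2 / 2 - h] with [c] and [h(0)] nonzero, so that
   [p = c^3 t^6 / 4 + 3 c t^2 h^2].  For a second such representation [(d, k)], the
   polynomial [c h^2 - d k^2] is a multiple of [t^4]; it factors into two polynomials
   of degree at most 2, one of which is nonzero at [0], so the other one vanishes and
   [k = r h] with [c = d r^2]; finally [c^3 = d^3] gives [r^6 = 1].  The coefficient of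
   [t^2] tells the two cases apart. *)
Require Import Defs.
From mathcomp Require Import all_boot all_order all_algebra.
From mathcomp Require Import finmap complex mpoly ring.
From mathcomp Require Import boolp classical_sets cardinality.
From mathcomp Require Import reals constructive_ereal counting_measure.
Set Implicit Arguments.
Unset Strict Implicit.
Unset Printing Implicit Defensive.
Import Order.TTheory GRing.Theory Num.Theory.
Local Open Scope ring_scope.

(** * Sums of two cubes of univariate quadratics *)

Section Field.
Variable F : numFieldType.
Implicit Types f g : {poly F}.

(* Contract the symmetric tensors [m1^3 + m2^3] and [n1^3 + n2^3] with the basis dual to [m1, m2]. *)
Lemma binary_cubic_uniq (a1 b1 a2 b2 d1 e1 d2 e2 : F) :
  b1 * a2 - b2 * a1 != 0 -> e1 * d2 - e2 * d1 != 0 ->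
  b1 ^+ 3 + b2 ^+ 3 = e1 ^+ 3 + e2 ^+ 3 ->
  b1 ^+ 2 * a1 + b2 ^+ 2 * a2 = e1 ^+ 2 * d1 + e2 ^+ 2 * d2 ->
  b1 * a1 ^+ 2 + b2 * a2 ^+ 2 = e1 * d1 ^+ 2 + e2 * d2 ^+ 2 ->
  a1 ^+ 3 + a2 ^+ 3 = d1 ^+ 3 + d2 ^+ 3 ->
  exists z1 z2, [/\ z1 ^+ 3 = 1, z2 ^+ 3 = 1 &
    [/\ d1 = z1 * a1, e1 = z1 * b1, d2 = z2 * a2 & e2 = z2 * b2] \/
    [/\ d1 = z1 * a2, e1 = z1 * b2, d2 = z2 * a1 & e2 = z2 * b1]].
Proof.
set D := b1 * a2 - b2 * a1 => D0 E0 h0 h1 h2 h3.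
(* Cramer's rule: [(u1, v1)] and [(u2, v2)] are the coordinates of [(d1, e1)] and [(d2, e2)] in the
   basis [(a1, b1)], [(a2, b2)]. *)
pose u1 := (e1 * a2 - d1 * b2) / D; pose v1 := (d1 * b1 - e1 * a1) / D.
pose u2 := (e2 * a2 - d2 * b2) / D; pose v2 := (d2 * b1 - e2 * a1) / D.
have e1E : e1 = u1 * b1 + v1 * b2 by rewrite /u1 /v1; move: D0; rewrite /D => ?; field.
have d1E : d1 = u1 * a1 + v1 * a2 by rewrite /u1 /v1; move: D0; rewrite /D => ?; field.
have e2E : e2 = u2 * b1 + v2 * b2 by rewrite /u2 /v2; move: D0; rewrite /D => ?; field.
have d2E : d2 = u2 * a1 + v2 * a2 by rewrite /u2 /v2; move: D0; rewrite /D => ?; field.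
(* A binary cubic determines its polarization, so the two symmetric trilinear forms agree on any
   three covectors. *)
have contract (p q p' q' p'' q'' : F) :
    (p * e1 + q * d1) * (p' * e1 + q' * d1) * (p'' * e1 + q'' * d1) +
    (p * e2 + q * d2) * (p' * e2 + q' * d2) * (p'' * e2 + q'' * d2) =
    (p * b1 + q * a1) * (p' * b1 + q' * a1) * (p'' * b1 + q'' * a1) +
    (p * b2 + q * a2) * (p' * b2 + q' * a2) * (p'' * b2 + q'' * a2).
  apply/eqP; rewrite -subr_eq0; apply/eqP.
  transitivity (p * p' * p'' * (e1 ^+ 3 + e2 ^+ 3 - (b1 ^+ 3 + b2 ^+ 3))
    + (p * p' * q'' + p * q' * p'' + q * p' * p'') *
      (e1 ^+ 2 * d1 + e2 ^+ 2 * d2 - (b1 ^+ 2 * a1 + b2 ^+ 2 * a2))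
    + (p * q' * q'' + q * q' * p'' + q * p' * q'') *
      (e1 * d1 ^+ 2 + e2 * d2 ^+ 2 - (b1 * a1 ^+ 2 + b2 * a2 ^+ 2))
    + q * q' * q'' * (d1 ^+ 3 + d2 ^+ 3 - (a1 ^+ 3 + a2 ^+ 3))); first by ring.
  by rewrite h0 h1 h2 h3 !subrr; ring.
have dual1 : [/\ a2 / D * b1 + - b2 / D * a1 = 1, a2 / D * b2 + - b2 / D * a2 = 0,
    a2 / D * e1 + - b2 / D * d1 = u1 & a2 / D * e2 + - b2 / D * d2 = u2].
  by rewrite /u1 /u2; move: D0; rewrite /D => ?; split; field.
have dual2 : [/\ - a1 / D * b1 + b1 / D * a1 = 0, - a1 / D * b2 + b1 / D * a2 = 1,
    - a1 / D * e1 + b1 / D * d1 = v1 & - a1 / D * e2 + b1 / D * d2 = v2].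
  by rewrite /v1 /v2; move: D0; rewrite /D => ?; split; field.
case: dual1 => x1 x2 x3 x4; case: dual2 => y1 y2 y3 y4.
have c0 := contract (a2 / D) (- b2 / D) (a2 / D) (- b2 / D) (a2 / D) (- b2 / D).
have c1 := contract (a2 / D) (- b2 / D) (a2 / D) (- b2 / D) (- a1 / D) (b1 / D).
have c2 := contract (a2 / D) (- b2 / D) (- a1 / D) (b1 / D) (- a1 / D) (b1 / D).
have c3 := contract (- a1 / D) (b1 / D) (- a1 / D) (b1 / D) (- a1 / D) (b1 / D).
move: c0 c1 c2 c3; rewrite x1 x2 x3 x4 y1 y2 y3 y4 => c0 c1 c2 c3.
clear contract x1 x2 x3 x4 y1 y2 y3 y4.
have W0 : u1 * v2 - u2 * v1 != 0.
  apply: contraNneq E0 => w.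
  have -> : e1 * d2 - e2 * d1 = (u1 * v2 - u2 * v1) * D.
    by rewrite e1E d1E e2E d2E /D; ring.
  by rewrite w mul0r.
(* [c1] and [c2] form a homogeneous linear system in the unknowns [u1 * v1] and [u2 * v2], with
   determinant [u1 * v2 - u2 * v1]. *)
have uv1 : u1 * v1 = 0.
  apply: (mulIf W0); rewrite mul0r.
  transitivity ((u1 * u1 * v1 + u2 * u2 * v2) * v2 -
    (u1 * v1 * v1 + u2 * v2 * v2) * u2); first by ring.
  by rewrite c1 c2; ring.
have uv2 : u2 * v2 = 0.
  apply: (mulIf W0); rewrite mul0r.
  transitivity ((u1 * v1 * v1 + u2 * v2 * v2) * u1 -
    (u1 * u1 * v1 + u2 * u2 * v2) * v1); first by ring.
  by rewrite c1 c2; ring.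
(* Each new vector is thus a multiple of one old vector. [W0] forbids both from picking the same
   one, and [c0], [c3] make the multipliers cube roots of unity. *)
move/eqP: uv1; rewrite mulf_eq0 => /orP[] /eqP z1; last first.
  move/eqP: uv2; rewrite mulf_eq0 => /orP[] /eqP z2; last first.
    by move: W0; rewrite z1 z2 !mulr0 subrr eqxx.
  exists u1, v2; split.
  - by rewrite -[RHS]addr0; move: c0; rewrite z2 !mulr1 !mulr0 => <-; ring.
  - by rewrite -[RHS]add0r; move: c3; rewrite z1 !mulr1 !mulr0 => <-; ring.
  by left; rewrite e1E d1E e2E d2E z1 z2 !mul0r !addr0 !add0r.
move/eqP: uv2; rewrite mulf_eq0 => /orP[] /eqP z2.
  by move: W0; rewrite z1 z2 !mul0r subrr eqxx.
exists v1, u2; split.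
- by rewrite -[RHS]add0r; move: c3; rewrite z2 !mulr1 !mulr0 => <-; ring.
- by rewrite -[RHS]addr0; move: c0; rewrite z1 !mulr1 !mulr0 => <-; ring.
by right; rewrite e1E d1E e2E d2E z1 z2 !mul0r !addr0 !add0r.
Qed.

(* The hypotheses equate the coefficients of degrees 2, 3, 4 and 6 of [f1^3 + f2^3] and
   [g1^3 + g2^3], for [f1 = a1 t^2 + b t + c], [f2 = a2 t^2 - b t - c],
   [g1 = d1 t^2 + e t + k] and [g2 = d2 t^2 - e t - k]. *)
Lemma opposite_quadratics_uniq (a1 a2 b c d1 d2 e k : F) :
  c != 0 -> k != 0 -> a1 + a2 != 0 -> d1 + d2 != 0 ->
  (a1 + a2) * c ^+ 2 = (d1 + d2) * k ^+ 2 ->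
  (a1 + a2) * (b * c) = (d1 + d2) * (e * k) ->
  (a1 + a2) * (b ^+ 2 + (a1 - a2) * c) = (d1 + d2) * (e ^+ 2 + (d1 - d2) * k) ->
  a1 ^+ 3 + a2 ^+ 3 = d1 ^+ 3 + d2 ^+ 3 ->
  exists z, z ^+ 3 = 1 /\
    ([/\ d1 = z * a1, d2 = z * a2, e = z * b & k = z * c] \/
     [/\ d1 = z * a2, d2 = z * a1, e = - z * b & k = - z * c]).
Proof.
move=> c0 k0 A0 D0 h2 h3 h4 h6.
pose r := k / c.
have r0 : r != 0 by rewrite mulf_neq0 ?invr_eq0.
have kE : k = r * c by rewrite /r; field.
have two0 : (2%:R : F) != 0 by rewrite pnatr_eq0.
have AE : a1 + a2 = (d1 + d2) * r ^+ 2.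
  apply: (mulIf (expf_neq0 2 c0)); rewrite h2 kE; ring.
have eE : e = r * b.
  apply: (mulIf (mulf_neq0 (mulf_neq0 D0 r0) c0)).
  transitivity ((d1 + d2) * (e * k)); first by rewrite kE; ring.
  by rewrite -h3 AE; ring.
have dE : d1 - d2 = r * (a1 - a2).
  apply: (mulIf (mulf_neq0 (mulf_neq0 D0 r0) c0)).
  transitivity ((d1 + d2) * (e ^+ 2 + (d1 - d2) * k) - (d1 + d2) * e ^+ 2).
    by rewrite kE; ring.
  by rewrite -h4 AE eE; ring.
(* Use [4 (x^3 + y^3) = (x + y)^3 + 3 (x + y) (x - y)^2]: by [AE] and [dE] the last terms agree on
   both sides, so the cubes of the sums agree as well. *)
have r6 : (r ^+ 3 - 1) * (r ^+ 3 + 1) = 0.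
  apply: (mulIf (expf_neq0 3 D0)); rewrite mul0r.
  transitivity ((a1 + a2) ^+ 3 - (d1 + d2) ^+ 3); first by rewrite AE; ring.
  transitivity (4%:R * (a1 ^+ 3 + a2 ^+ 3) - 3%:R * (a1 + a2) * (a1 - a2) ^+ 2 -
    (4%:R * (d1 ^+ 3 + d2 ^+ 3) - 3%:R * (d1 + d2) * (d1 - d2) ^+ 2)); first by ring.
  by rewrite h6 AE dE; ring.
have d1E : d1 * 2%:R = (d1 + d2) + r * (a1 - a2) by rewrite -dE; ring.
have d2E : d2 * 2%:R = (d1 + d2) - r * (a1 - a2) by rewrite -dE; ring.
move/eqP: r6; rewrite mulf_eq0 subr_eq0 addr_eq0 => /orP[] /eqP r3.
  have SE : d1 + d2 = r * (a1 + a2).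
    by rewrite AE; transitivity ((d1 + d2) * r ^+ 3); [rewrite r3 mulr1 | ring].
  exists r; split=> //; left; split=> //; apply: (mulIf two0).
    by rewrite d1E SE; ring.
  by rewrite d2E SE; ring.
(* When [r^3 = -1], the sum is scaled by [- r] but the difference by [r], which exchanges the two
   leading coefficients. *)
have SE : d1 + d2 = - r * (a1 + a2).
  rewrite AE; transitivity (- ((d1 + d2) * r ^+ 3)); last by ring.
  by rewrite r3; ring.
exists (- r); split; first by rewrite exprNn r3; ring.
right; rewrite opprK; split=> //; apply: (mulIf two0).
  by rewrite d1E SE; ring.
by rewrite d2E SE; ring.
Qed.

Lemma quadratic_polyP f g : (size f <= 3)%N -> (size g <= 3)%N ->
  f`_0 = g`_0 -> f`_1 = g`_1 -> f`_2 = g`_2 -> f = g.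
Proof.
move=> sf sg h0 h1 h2; apply/polyP=> -[|[|[|i]]] //.
by rewrite !nth_default // (leq_trans _ (isT : (3 <= i.+3)%N)).
Qed.

Lemma coef_quadratic_cube f : (size f <= 3)%N ->
  [/\ (f ^+ 3)`_0 = f`_0 ^+ 3,
      (f ^+ 3)`_1 = 3%:R * (f`_1 * f`_0 ^+ 2),
      (f ^+ 3)`_2 = 3%:R * (f`_2 * f`_0 ^+ 2 + f`_1 ^+ 2 * f`_0),
      (f ^+ 3)`_3 = 6%:R * (f`_2 * f`_1 * f`_0) + f`_1 ^+ 3 &
  [/\ (f ^+ 3)`_4 = 3%:R * (f`_2 ^+ 2 * f`_0 + f`_2 * f`_1 ^+ 2),
      (f ^+ 3)`_5 = 3%:R * (f`_2 ^+ 2 * f`_1) &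
      (f ^+ 3)`_6 = f`_2 ^+ 3]].
Proof.
move=> sf; set a := f`_2; set b := f`_1; set c := f`_0.
have -> : f = Poly [:: c; b; a].
  apply: quadratic_polyP => //; rewrite ?coef_Poly //.
  exact: size_Poly.
have -> : Poly [:: c; b; a] ^+ 3 = Poly [:: c ^+ 3; 3%:R * (b * c ^+ 2);
    3%:R * (a * c ^+ 2 + b ^+ 2 * c); 6%:R * (a * b * c) + b ^+ 3;
    3%:R * (a ^+ 2 * c + a * b ^+ 2); 3%:R * (a ^+ 2 * b); a ^+ 3].
  by rewrite /= !cons_poly_def; ring.
by rewrite !coef_Poly.
Qed.

Lemma scaled_cube (z : F) f : z ^+ 3 = 1 -> (z *: f) ^+ 3 = f ^+ 3.
Proof. by move=> z3; rewrite exprZn z3 scale1r. Qed.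

(** Linear independence, written as an equality of multiples to match the negation of
    [proportional]. *)
Definition noncollinear (V : lmodType F) (u v : V) :=
  forall a b : F, a *: u = b *: v -> a = 0 /\ b = 0.

Lemma noncollinear_det_neq0 f g : (size f <= 3)%N -> (size g <= 3)%N ->
  noncollinear f g -> f`_0 = 0 -> g`_0 = 0 -> f`_1 * g`_2 - g`_1 * f`_2 != 0.
Proof.
move=> sf sg nfg f0 g0; apply/negP; rewrite subr_eq0 => /eqP det0.
have scale_eq a b : a * f`_1 = b * g`_1 -> a * f`_2 = b * g`_2 -> a *: f = b *: g.
  by move=> h1 h2; apply: quadratic_polyP; rewrite ?coefZ ?f0 ?g0 ?mulr0 //
    (leq_trans (size_scale_leq _ _)).
(* A zero determinant makes the degree 1 coefficients, and then those of degree 2, the coefficients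
   of a linear relation between [f] and [g]; hence they vanish and [f = 0]. *)
have [_ f1] : g`_1 = 0 /\ f`_1 = 0.
  by apply/nfg/scale_eq; [rewrite mulrC | rewrite det0].
have [_ f2] : g`_2 = 0 /\ f`_2 = 0.
  by apply/nfg/scale_eq; [rewrite mulrC det0 mulrC | rewrite mulrC].
have [] : (1 : F) = 0 /\ (0 : F) = 0 by apply/nfg/scale_eq; rewrite ?f1 ?f2 ?mulr0 ?mul0r.
by move/eqP; rewrite oner_eq0.
Qed.

(* Either [t] divides both quadratics, or, after scaling [f2] by a cube root of
   unity, [f1 + f2] is a nonzero multiple of [t ^ 2]. *)
Lemma sum_of_cubes_double_root f1 f2 : (size f1 <= 3)%N -> (size f2 <= 3)%N ->
  noncollinear f1 f2 -> 'X^2 %| f1 ^+ 3 + f2 ^+ 3 ->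
  [/\ f1`_0 = 0, f2`_0 = 0 & (f1 ^+ 3 + f2 ^+ 3)`_2 = 0] \/
  (f1`_0 != 0 /\ exists z a, [/\ z ^+ 3 = 1, z != 0,
     z *: f2 = Poly [:: - f1`_0; - f1`_1; a] & f1`_2 + a != 0 /\
   [/\ (f1 ^+ 3 + f2 ^+ 3)`_2 = 3%:R * ((f1`_2 + a) * f1`_0 ^+ 2),
       (f1 ^+ 3 + f2 ^+ 3)`_3 = 6%:R * ((f1`_2 + a) * (f1`_1 * f1`_0)),
       (f1 ^+ 3 + f2 ^+ 3)`_4 =
         3%:R * ((f1`_2 + a) * (f1`_1 ^+ 2 + (f1`_2 - a) * f1`_0)) &
       (f1 ^+ 3 + f2 ^+ 3)`_6 = f1`_2 ^+ 3 + a ^+ 3]]).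
Proof.
move=> s1 s2 nf /dvdpP[q hq].
have [p0 p1 p2 p3 [p4 _ p6]] := coef_quadratic_cube s1.
have [q0 q1 q2 _ _] := coef_quadratic_cube s2.
have h0 : f1`_0 ^+ 3 + f2`_0 ^+ 3 = 0 by rewrite -p0 -q0 -coefD hq coefMXn.
have h1 : f1`_1 * f1`_0 ^+ 2 + f2`_1 * f2`_0 ^+ 2 = 0.
  have three0 : (3%:R : F) != 0 by rewrite pnatr_eq0.
  by apply: (mulfI three0); rewrite mulrDr -p1 -q1 -coefD hq coefMXn mulr0.
have [c0|c0] := eqVneq f1`_0 0; [left|right].
  have f20 : f2`_0 = 0.
    by apply/eqP; move/eqP: h0; rewrite c0 expr0n add0r expf_eq0.
  by rewrite coefD p2 q2 c0 f20; split=> //; ring.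
split=> //.
have f20 : f2`_0 != 0.
  apply: contraNneq c0 => f20; move/eqP: h0.
  by rewrite f20 expr0n addr0 expf_eq0.
(* [z] makes the constant terms of [f1] and [z *: f2] opposite. The degree 0 coefficient of the sum
   of cubes gives [z^3 = 1]; the degree 1 coefficient then makes the linear terms opposite. *)
pose z := - (f1`_0 / f2`_0); pose a := z * f2`_2.
have zE : z * f2`_0 = - f1`_0 by rewrite /z; field.
have z0 : z != 0 by rewrite oppr_eq0 mulf_neq0 ?invr_eq0.
have z3 : z ^+ 3 = 1.
  apply: (mulIf (expf_neq0 3 f20)).
  transitivity (f2`_0 ^+ 3 - (f1`_0 ^+ 3 + f2`_0 ^+ 3)); last by rewrite h0; ring.
  by rewrite -exprMn zE; ring.
have zE1 : z * f2`_1 = - f1`_1.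
  apply: (mulIf (expf_neq0 2 c0)).
  transitivity ((f1`_1 * f1`_0 ^+ 2 + f2`_1 * f2`_0 ^+ 2) - f1`_1 * f1`_0 ^+ 2).
    have -> : f1`_0 = - (z * f2`_0) by rewrite zE opprK.
    by transitivity (z ^+ 3 * (f2`_1 * f2`_0 ^+ 2)); [|rewrite z3]; ring.
  by rewrite h1; ring.
have zf2 : z *: f2 = Poly [:: - f1`_0; - f1`_1; a].
  apply: quadratic_polyP; rewrite ?coefZ ?coef_Poly //.
    exact: leq_trans (size_scale_leq _ _) _.
  exact: size_Poly.
(* Otherwise [z *: f2 = - f1], against independence. *)
have ns : f1`_2 + a != 0.
  rewrite addrC addr_eq0; apply: contraNneq z0 => aE.
  suff [_ ->] : (- 1 : F) = 0 /\ z = 0 by [].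
  apply: nf.
  apply: quadratic_polyP; rewrite ?coefZ ?zE ?zE1 -?/a ?aE ?mulN1r //;
    exact: leq_trans (size_scale_leq _ _) _.
exists z, a; split=> //; split=> //.
rewrite -(scaled_cube f2 z3) zf2 !coefD p2 p3 p4 p6.
have [_ _ -> -> [-> _ ->]] := coef_quadratic_cube (size_Poly [:: - f1`_0; - f1`_1; a]).
rewrite !coef_Poly /=.
by split; ring.
Qed.

Lemma sums_of_cubes_uniq f1 f2 g1 g2 :
  (size f1 <= 3)%N -> (size f2 <= 3)%N -> (size g1 <= 3)%N -> (size g2 <= 3)%N ->
  noncollinear f1 f2 -> noncollinear g1 g2 ->
  'X^2 %| f1 ^+ 3 + f2 ^+ 3 -> f1 ^+ 3 + f2 ^+ 3 = g1 ^+ 3 + g2 ^+ 3 ->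
  exists z1 z2, [/\ z1 ^+ 3 = 1, z2 ^+ 3 = 1 &
    (g1 = z1 *: f1 /\ g2 = z2 *: f2) \/ (g1 = z1 *: f2 /\ g2 = z2 *: f1)].
Proof.
move=> sf1 sf2 sg1 sg2 nf ng fX fg.
have gX : 'X^2 %| g1 ^+ 3 + g2 ^+ 3 by rewrite -fg.
have three0 : (3%:R : F) != 0 by rewrite pnatr_eq0.
have six0 : (6%:R : F) != 0 by rewrite pnatr_eq0.
have eq_scale (z : F) (u v : {poly F}) :
    (size u <= 3)%N -> (size v <= 3)%N -> u`_0 = z * v`_0 ->
    u`_1 = z * v`_1 -> u`_2 = z * v`_2 -> u = z *: v.
  by move=> su sv h0 h1 h2; apply: quadratic_polyP; rewrite ?coefZ //
    (leq_trans (size_scale_leq _ _)).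
have := sum_of_cubes_double_root sf1 sf2 nf fX.
have := sum_of_cubes_double_root sg1 sg2 ng gX.
rewrite -fg.
case=> [[k1 k2 P2]|[k0 [w [d [w3 w0 wg2 [d0 [P2 P3 P4 P6]]]]]]];
case=> [[c1 c2 P2']|[c0 [z [a [z3 z0 zf2 [a0 [P2' P3' P4' P6']]]]]]].
(* All four quadratics are divisible by [t]: after division by [t^3], degrees 3 to 6 compare two
   sums of cubes of linear polynomials. *)
- have [_ _ _ p3 [p4 p5 p6]] := coef_quadratic_cube sf1.
  have [_ _ _ p3' [p4' p5' p6']] := coef_quadratic_cube sf2.
  have [_ _ _ q3 [q4 q5 q6]] := coef_quadratic_cube sg1.
  have [_ _ _ q3' [q4' q5' q6']] := coef_quadratic_cube sg2.
  have e i : (f1 ^+ 3)`_i + (f2 ^+ 3)`_i = (g1 ^+ 3)`_i + (g2 ^+ 3)`_i.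
    by rewrite -!coefD fg.
  have := e 3; have := e 4; have := e 5; have := e 6.
  rewrite p3 p3' p4 p4' p5 p5' p6 p6' q3 q3' q4 q4' q5 q5' q6 q6'.
  rewrite c1 c2 k1 k2 !mulr0 !add0r -!mulrDr => e6 /(mulfI three0) e5 /(mulfI three0) e4 e3.
  have [||z1 [z2 [z13 z23 H]]] := binary_cubic_uniq
    (noncollinear_det_neq0 sf1 sf2 nf c1 c2) (noncollinear_det_neq0 sg1 sg2 ng k1 k2)
    e3 _ _ e6.
  + by rewrite !(mulrC (_ ^+ 2)).
  + by rewrite !(mulrC _ (_ ^+ 2)).
  exists z1, z2; split=> //.
  by case: H => -[*]; [left|right]; split; apply: eq_scale;
     rewrite ?c1 ?c2 ?k1 ?k2 ?mulr0.
(* Mixed cases: the coefficient of [t^2] would be both zero and nonzero. *)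
- by have := mulf_neq0 three0 (mulf_neq0 a0 (expf_neq0 2 c0)); rewrite -P2' P2 eqxx.
- by have := mulf_neq0 three0 (mulf_neq0 d0 (expf_neq0 2 k0)); rewrite -P2 P2' eqxx.
have E2 : (f1`_2 + a) * f1`_0 ^+ 2 = (g1`_2 + d) * g1`_0 ^+ 2.
  by apply: (mulfI three0); rewrite -P2' P2.
have E3 : (f1`_2 + a) * (f1`_1 * f1`_0) = (g1`_2 + d) * (g1`_1 * g1`_0).
  by apply: (mulfI six0); rewrite -P3' P3.
have E4 : (f1`_2 + a) * (f1`_1 ^+ 2 + (f1`_2 - a) * f1`_0) =
    (g1`_2 + d) * (g1`_1 ^+ 2 + (g1`_2 - d) * g1`_0).
  by apply: (mulfI three0); rewrite -P4' P4.
have [y [y3 H]] := opposite_quadratics_uniq c0 k0 a0 d0 E2 E3 E4 (etrans (esym P6') P6).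
have g2E : g2 = w^-1 *: Poly [:: - g1`_0; - g1`_1; d] by rewrite -wg2 scalerK.
have inv3 (x : F) : x ^+ 3 = 1 -> x^-1 ^+ 3 = 1 by move=> x3; rewrite exprVn x3 invr1.
(* [y] relates the normalized pairs [f1], [z *: f2] and [g1], [w *: g2]; the witnesses undo the
   normalization by [z] and [w]. *)
case: H => -[d1E dE eE kE].
  exists y, (w^-1 * y * z); split=> //; first by rewrite !exprMn inv3 // y3 z3 !mulr1.
  left; split; first exact: eq_scale.
  rewrite g2E -!scalerA zf2; congr (_ *: _).
  by apply: eq_scale; rewrite ?size_Poly // ?coef_Poly /= ?eE ?kE ?dE ?mulrN.
exists (y * z), (w^-1 * y); split; try by rewrite !exprMn ?inv3 // y3 ?z3 !mulr1.
right; split.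
  by rewrite -scalerA zf2; apply: eq_scale; rewrite ?size_Poly // ?coef_Poly /=
    ?eE ?kE ?d1E ?mulrN ?mulNr.
rewrite g2E -scalerA; congr (_ *: _).
by apply: eq_scale; rewrite ?size_Poly // ?coef_Poly /= ?eE ?kE ?dE ?mulNr ?opprK.
Qed.

End Field.

(** * From binary forms to univariate polynomials *)

Section Forms.
Variable F : numFieldType.
Implicit Types (f g l : {mpoly F[2]}) (i j : 'I_2).

Lemma big_ord2 (T : Type) (idx : T) (op : Monoid.com_law idx) (G : 'I_2 -> T) i j :
  i != j -> \big[op/idx]_k G k = op (G i) (G j).
Proof.
move=> ij; rewrite (bigD1 i) //= (bigD1 j) 1?eq_sym //= big1 ?Monoid.mulm1 // => k.
by move: i j k ij; do 3![case=> [[|[|//]] ?]].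
Qed.

(** The order of the variables is left free so that a linear form can be solved for whichever
    variable has a nonzero coefficient. *)
Lemma binary_formE d f i j : i != j -> f \is d.-homog ->
  exists c : nat -> F, f = \sum_(k < d.+1) c k *: ('X_i ^+ k * 'X_j ^+ (d - k)).
Proof.
move=> ij /dhomogP hf; rewrite [f]mpolyE big_seq.
apply: (big_ind (fun g => exists c : nat -> F, g = _)).
- by exists (fun=> 0); rewrite big1 // => k _; rewrite scale0r.
- move=> _ _ [c ->] [c' ->]; exists (fun k => c k + c' k).
  by rewrite -big_split; apply: eq_bigr => k _; rewrite scalerDl.
move=> m /hf; rewrite /= mdegE (big_ord2 _ _ ij) /= => md.
have mi : (m i < d.+1)%N by rewrite ltnS -md leq_addr.
exists (fun k => if k == m i then f@_m else 0).
rewrite (bigD1 (Ordinal mi)) //= eqxx big1 ?addr0.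
  by rewrite mpolyXE_id (big_ord2 _ _ ij) -md addKn.
by move=> k /negbTE; rewrite -val_eqE /= => ->; rewrite scale0r.
Qed.

Lemma linear_form_neq0E l : l \is 1.-homog -> l != 0 ->
  exists i j (a b : F), [/\ i != j, a != 0 & l = a *: 'X_i + b *: 'X_j].
Proof.
move=> hl l0; have ij : (ord0 : 'I_2) != ord_max by [].
have [c lE] := binary_formE ij hl.
have {lE} lE : l = c 1%N *: 'X_ord0 + c 0%N *: 'X_ord_max.
  by rewrite lE 2!big_ord_recr big_ord0 /= add0r addrC !(expr0, expr1, mul1r, mulr1).
have [c1|c1] := eqVneq (c 1%N) 0; last by exists ord0, ord_max, (c 1%N), (c 0%N).
exists ord_max, ord0, (c 0%N), (c 1%N); split=> //; last by rewrite addrC.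
by apply: contraNneq l0 => c0; rewrite lE c0 c1 !scale0r addr0.
Qed.

(* Substitute [1] for one variable and solve [l = t] for the other. *)
Lemma dehomogenize l : l \is 1.-homog -> l != 0 ->
  exists phi : {rmorphism {mpoly F[2]} -> {poly F}},
    [/\ phi l = 'X, forall a f, phi (a *: f) = a *: phi f &
      forall f, f \is 2.-homog -> (size (phi f) <= 3)%N /\ (phi f = 0 -> f = 0)].
Proof.
move=> hl /(linear_form_neq0E hl) [i [j [a [b [ij a0 lE]]]]].
pose h k : {poly F} := if k == i then a^-1 *: ('X - b%:P) else 1.
pose phi : {rmorphism {mpoly F[2]} -> {poly F}} := mmap (@polyC F) h.
have phiZ c f : phi (c *: f) = c *: phi f by rewrite /= mmapZ mul_polyC.
have phiX k : phi 'X_k = h k by rewrite /= mmapX mmap1U.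
have hi : h i = a^-1 *: ('X - b%:P) by rewrite /h eqxx.
have hj : h j = 1 by rewrite /h eq_sym (negbTE ij).
exists phi; split=> //.
  rewrite lE rmorphD !phiZ !phiX hi hj scalerA divff // scale1r.
  by rewrite alg_polyC subrK.
move=> f /(binary_formE ij) [c ->].
rewrite 3!big_ord_recr big_ord0 /= add0r !(expr0, expr1, mul1r, mulr1).
rewrite !rmorphD !phiZ !rmorphXn !rmorphM !phiX hi hj expr1n mulr1.
set u := a^-1.
have -> : c 0%N *: 1 + c 1%N *: (u *: ('X - b%:P)) + c 2 *: (u *: ('X - b%:P)) ^+ 2
    = Poly [:: c 0%N - c 1%N * u * b + c 2 * u ^+ 2 * b ^+ 2;
              c 1%N * u - (c 2 * u ^+ 2 * b) *+ 2; c 2 * u ^+ 2] :> {poly F}.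
  by rewrite /= !cons_poly_def -!mul_polyC; ring.
split=> [|/polyP P0]; first exact: size_Poly.
have u0 : u != 0 by rewrite invr_eq0.
(* The system is triangular with diagonal [u^2], [u], [1]; it is solved from the top degree down. *)
have c2 : c 2 = 0.
  by apply: (mulIf (expf_neq0 2 u0)); have := P0 2; rewrite coef_Poly coef0 mul0r.
have c1 : c 1%N = 0.
  by apply: (mulIf u0); have := P0 1%N; rewrite coef_Poly coef0 /= c2 !mul0r mul0rn subr0.
have c0 : c 0%N = 0.
  by have := P0 0%N; rewrite coef_Poly coef0 /= c1 c2 !mul0r subr0 addr0.
by rewrite c0 c1 c2 !scale0r !addr0.
Qed.

(** The ring morphism [phi] preserves cubes and sends [l^2] to ['X^2]. Its faithfulness, applied to
    [a *: f - b *: g], carries independence to the polynomials and proportionality back to the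
    forms. *)
Lemma sums_of_cubes_of_forms_uniq l q f1 f2 g1 g2 :
  l \is 1.-homog -> l != 0 ->
  f1 \is 2.-homog -> f2 \is 2.-homog -> g1 \is 2.-homog -> g2 \is 2.-homog ->
  noncollinear f1 f2 -> noncollinear g1 g2 ->
  f1 ^+ 3 + f2 ^+ 3 = l ^+ 2 * q -> f1 ^+ 3 + f2 ^+ 3 = g1 ^+ 3 + g2 ^+ 3 ->
  (g1 ^+ 3 = f1 ^+ 3 /\ g2 ^+ 3 = f2 ^+ 3) \/ (g1 ^+ 3 = f2 ^+ 3 /\ g2 ^+ 3 = f1 ^+ 3).
Proof.
move=> hl l0 hf1 hf2 hg1 hg2 nf ng fl fg.
have [phi [phil phiZ phi2]] := dehomogenize hl l0.
have inj a b f g : f \is 2.-homog -> g \is 2.-homog ->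
    a *: phi f = b *: phi g -> a *: f = b *: g.
  move=> hf hg /eqP; rewrite -!phiZ -subr_eq0 -rmorphB => /eqP e.
  apply/eqP; rewrite -subr_eq0; apply/eqP.
  by apply: (phi2 _ _).2 => //; rewrite rpredB ?rpredZ.
have cubes z f g : f \is 2.-homog -> g \is 2.-homog -> z ^+ 3 = 1 ->
    phi g = z *: phi f -> g ^+ 3 = f ^+ 3.
  move=> hf hg z3; rewrite -[phi g]scale1r => /(inj _ _ _ _ hg hf).
  by rewrite scale1r => ->; rewrite exprZn z3 scale1r.
have [||z1 [z2 [z13 z23 H]]] := sums_of_cubes_uniq (phi2 _ hf1).1 (phi2 _ hf2).1
    (phi2 _ hg1).1 (phi2 _ hg2).1 (fun a b e => nf a b (inj _ _ _ _ hf1 hf2 e))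
    (fun a b e => ng a b (inj _ _ _ _ hg1 hg2 e)).
- by rewrite -!rmorphXn -rmorphD fl rmorphM rmorphXn phil dvdp_mulr.
- by rewrite -!rmorphXn -!rmorphD fg.
case: H => -[e1 e2]; [left|right]; split;
  [exact: cubes e1|exact: cubes e2|exact: cubes e1|exact: cubes e2].
Qed.

End Forms.

(** * Counting the representations *)

Lemma counting_le1 (R : realType) (T : choiceType) (A : set T) :
  (forall x y, A x -> A y -> x = y) -> (counting A <= (1 : \bar R))%E.
Proof.
move=> A1; rewrite /counting.
have [->|/set0P[x Ax]] := eqVneq A set0.
  by rewrite asboolT // fset_set0 lee_fin.
have -> : A = [set x]%classic.
  by apply/seteqP; split=> [y Ay|y ->]; [exact: A1|].
by rewrite asboolT // fset_set1 cardfs1.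
Qed.

Local Open Scope complex_scope.

Lemma not_proportional_noncollinear (R : realType) (f g : {mpoly R[i][2]}) :
  ~ proportional f g -> noncollinear f g.
Proof.
move=> nfg a b e; suff /eqP[-> ->] : (a, b) == (0, 0) by [].
by apply: contra_notT nfg => ab; exists a, b.
Qed.

Theorem theorem5p7 (R : realType) (p : {mpoly R[i][2]})
    (hp : p \is 6.-homog)
    (hdiv : exists l q : {mpoly R[i][2]}, l \is 1.-homog /\ p = l ^+ 2 * q) :
  (N p <= 1)%E.
Proof.
have {hdiv} [l [q [hl l0 pE]]] : exists l q : {mpoly R[i][2]},
    [/\ l \is 1.-homog, l != 0 & p = l ^+ 2 * q].
  have [l [q [hl pE]]] := hdiv.
  (* The divisor [l] may be zero; then [p = 0], which is also divisible by the square of the nonzero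
     form ['X_ord0]. *)
  have [l0|l0] := eqVneq l 0; last by exists l, q.
  exists 'X_ord0, 0; split; first by rewrite dhomogX /= mdeg1.
    by apply/eqP => /(congr1 (mcoeff U_(ord0))) /eqP; rewrite mcoeffX eqxx mcoeff0 oner_eq0.
  by rewrite pE l0 expr0n mul0r mulr0.
apply: counting_le1 => S T [f1 [f2 [hf1 hf2 nf pf ->]]] [g1 [g2 [hg1 hg2 ng pg ->]]].
have fl : f1 ^+ 3 + f2 ^+ 3 = l ^+ 2 * q by rewrite -pf.
have fg : f1 ^+ 3 + f2 ^+ 3 = g1 ^+ 3 + g2 ^+ 3 by rewrite -pf.
have [[-> ->]|[-> ->]] := sums_of_cubes_of_forms_uniq hl l0 hf1 hf2 hg1 hg2
  (not_proportional_noncollinear nf) (not_proportional_noncollinear ng) fl fg.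
- reflexivity.
- exact: fsetUC.
Qed.
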